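(* Let $p$ be an odd prime. Define, for $s\in\mathbb Z_p$ and $z\in 1+p\mathbb Z_p$, \[\Gamma_p(s,z):=\exp_p(pz)\,\Gamma_p(s)\sum_{k=0}^{s-1}\frac{z^k}{\Gamma_p(k+1)}.\] Then $\Gamma_p(s,z)$ is the unique continuous function on $\mathbb Z_p\times(1+p\mathbb Z_p)$ satisfying (1) $\Gamma_p(1,z)=\exp_p(pz)$ for all $z\in1+p\mathbb Z_p$, and (2) $\Gamma_p(s+1,z)=h_p(s)\Gamma_p(s,z)+z^s\exp_p(pz)$ for all $s\in\mathbb Z_p$, $z\in 1+p\mathbb Z_p$, where $h_p(s)=-s$ if $s\in\mathbb Z_p^\times$ and $h_p(s)=-1$ if $s\in p\mathbb Z_p$.
   Context: $\Gamma_p$ denotes Morita's $p$-adic gamma function: the unique continuous function $\mathbb Z_p\to\mathbb Z_p$ with $\Gamma_p(n)=(-1)^n\prod_{1\le k<n,\ p\nmid k}k$ for positive integers $n$; it satisfies $\Gamma_p(s+1)=h_p(s)\Gamma_p(s)$ and $|\Gamma_p(s)|=1$ for all $s\in\mathbb Z_p$. $\exp_p(x)=\sum_{n\ge0}x^n/n!$ is the $p$-adic exponential, defined for $|x|<p^{-1/(p-1)}$, with inverse $\log_p$. For $z\in1+p\mathbb Z_p$ and $s\in\mathbb Z_p$, $z^s$ denotes the continuous extension of $n\mapsto z^n$ to $\mathbb Z_p$ (equivalently $\exp_p(s\log_p z)$). For $s\in\mathbb Z_p$, $\sum_{k=0}^{s-1}\frac{z^k}{\Gamma_p(k+1)}$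 denotes the value at $s$ of the unique continuous extension to $\mathbb Z_p$ of the partial-sum function $n\mapsto\sum_{k=0}^{n-1}\frac{z^k}{\Gamma_p(k+1)}$ on positive integers (this extension exists). $\mathbb Z_p\times(1+p\mathbb Z_p)$ carries the product of the $p$-adic topologies. *)

(* Defs.v *)
From HB Require Import structures.
From mathcomp Require Import all_boot all_order all_algebra generic_quotient.
From mathcomp Require Import all_classical all_reals all_analysis.

Set Implicit Arguments.
Unset Strict Implicit.
Unset Printing Implicit Defensive.

Import Order.TTheory GRing.Theory Num.Theory.

Local Open Scope classical_set_scope.
Local Open Scope ring_scope.

(* The ring Z_p is the inverse limit of the rings Z/p^n: [residue x n] is the  *)
(* representative in [0, p^n) of x mod p^n (the bound is part of               *)
(* [residueP]). The primality proof is a phantom argument of the type; it is   *)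
(* what makes the algebraic and metric instances available.                    *)
Record padicInt (p : nat) (p_pr : prime p) := PadicInt {
  residue : nat -> nat;
  residueP : forall n, (residue n.+1 %% p ^ n)%N = residue n }.

Section PadicIntRing.
Variables (p : nat) (p_pr : prime p).
Local Notation Zp := (padicInt p_pr).

HB.instance Definition _ := gen_eqMixin Zp.
HB.instance Definition _ := gen_choiceMixin Zp.

Lemma padicIntP (x y : Zp) : (forall n, residue x n = residue y n) -> x = y.
Proof.
case: x y => [x xP] [y yP] /= /funext exy; case: _ / exy in yP *.
by congr PadicInt; exact: Prop_irrelevance.
Qed.

Lemma residue_mod (x : Zp) m n :
  (m <= n)%N -> (residue x n %% p ^ m)%N = residue x m.
Proof.
elim: n => [|n IH]; first by rewrite leqn0 => /eqP ->; rewrite -residueP modn_mod.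
rewrite leq_eqVlt => /orP[/eqP ->|].
  by rewrite -(residueP x n.+1) modn_mod.
rewrite ltnS => mn; rewrite -(IH mn) -(residueP x n) modn_dvdm //.
by rewrite dvdn_exp2l.
Qed.

Lemma residue_modd (x : Zp) n : (residue x n %% p ^ n)%N = residue x n.
Proof. exact: residue_mod. Qed.

Fact padic_ofP (u : nat -> nat) : (forall n, u n.+1 = u n %[mod p ^ n]) ->
  forall n, ((u n.+1 %% p ^ n.+1) %% p ^ n = u n %% p ^ n)%N.
Proof. by move=> uP n; rewrite modn_dvdm ?uP // dvdn_exp2l. Qed.

Definition padic_of u (uP : forall n, u n.+1 = u n %[mod p ^ n]) : Zp :=
  PadicInt p_pr (padic_ofP uP).

Fact padic0_subproof n : 0 = 0 %[mod p ^ n]. Proof. by []. Qed.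
Fact padic1_subproof n : 1 = 1 %[mod p ^ n]. Proof. by []. Qed.

Lemma residueE (x : Zp) n : residue x n.+1 = residue x n %[mod p ^ n].
Proof. by rewrite residueP residue_modd. Qed.

Fact padicD_subproof (x y : Zp) n :
  residue x n.+1 + residue y n.+1 = residue x n + residue y n %[mod p ^ n].
Proof. by rewrite -modnDm !residueP. Qed.

Fact padicM_subproof (x y : Zp) n :
  residue x n.+1 * residue y n.+1 = residue x n * residue y n %[mod p ^ n].
Proof. by rewrite -modnMm !residueP. Qed.

Lemma residue_lt (x : Zp) n : (residue x n < p ^ n)%N.
Proof. by rewrite -residue_modd ltn_mod expn_gt0 prime_gt0. Qed.

Fact padicN_subproof (x : Zp) n :
  p ^ n.+1 - residue x n.+1 = p ^ n - residue x n %[mod p ^ n].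
Proof.
have lx := ltnW (residue_lt x n); have lx1 := ltnW (residue_lt x n.+1).
apply/eqP; rewrite -(eqn_modDr (residue x n.+1)) subnK //.
rewrite -(modnDmr (p ^ n - _)) residueP subnK //.
by rewrite modnn expnS modnMl.
Qed.

Definition padic0 := padic_of padic0_subproof.
Definition padic1 := padic_of padic1_subproof.
Definition padicD x y := padic_of (padicD_subproof x y).
Definition padicN x := padic_of (padicN_subproof x).
Definition padicM x y := padic_of (padicM_subproof x y).

Fact padicDA : associative padicD.
Proof. by move=> x y z; apply: padicIntP => n /=; rewrite modnDml modnDmr addnA. Qed.
Fact padicDC : commutative padicD.
Proof. by move=> x y; apply: padicIntP => n /=; rewrite addnC. Qed.
Fact padic0D : left_id padic0 padicD.
Proof. by move=> x; apply: padicIntP => n /=; rewrite mod0n add0n residue_modd. Qed.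
Fact padicND : left_inverse padic0 padicN padicD.
Proof.
move=> x; apply: padicIntP => n /=.
by rewrite modnDml subnK ?modnn ?mod0n // ltnW // residue_lt.
Qed.

HB.instance Definition _ :=
  GRing.isZmodule.Build Zp padicDA padicDC padic0D padicND.

Fact padicMA : associative padicM.
Proof. by move=> x y z; apply: padicIntP => n /=; rewrite modnMml modnMmr mulnA. Qed.
Fact padicMC : commutative padicM.
Proof. by move=> x y; apply: padicIntP => n /=; rewrite mulnC. Qed.
Fact padic1M : left_id padic1 padicM.
Proof. by move=> x; apply: padicIntP => n /=; rewrite modnMml mul1n residue_modd. Qed.
Fact padicMD : left_distributive padicM padicD.
Proof.
by move=> x y z; apply: padicIntP => n /=; rewrite modnMml modnDm mulnDl.
Qed.
Fact padic1_neq0 : padic1 != 0.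
Proof.
apply/eqP => /(congr1 (fun x => residue x 1)) /=.
by rewrite mod0n expn1 modn_small // prime_gt1.
Qed.

HB.instance Definition _ := GRing.Zmodule_isComNzRing.Build Zp
  padicMA padicMC padic1M padicMD padic1_neq0.

Lemma residue0 n : residue (0 : Zp) n = 0%N. Proof. exact: mod0n. Qed.
Lemma residue1 n : residue (1 : Zp) n = (1 %% p ^ n)%N. Proof. by []. Qed.
Lemma residueD (x y : Zp) n :
  residue (x + y) n = ((residue x n + residue y n) %% p ^ n)%N.
Proof. by []. Qed.
Lemma residueM (x y : Zp) n :
  residue (x * y) n = ((residue x n * residue y n) %% p ^ n)%N.
Proof. by []. Qed.
Lemma residue_nat k n : residue (k%:R : Zp) n = (k %% p ^ n)%N.
Proof.
elim: k => [|k IH]; first by rewrite residue0 mod0n.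
by rewrite -natr1 residueD IH residue1 modnDm addn1.
Qed.

Definition padic_unit : pred Zp := fun x => `[< exists y, y * x = 1 >].
Definition padic_inv (x : Zp) : Zp := xget x [set y | y * x = 1].

Fact padic_mulVr : {in padic_unit, left_inverse 1 padic_inv *%R}.
Proof.
move=> x /asboolP[y yx]; rewrite /padic_inv.
by case: xgetP => [z _ //|/(_ y)].
Qed.
Fact padic_unitP (x y : Zp) : y * x = 1 -> padic_unit x.
Proof. by move=> yx; apply/asboolP; exists y. Qed.
Fact padic_inv_out : {in [predC padic_unit], padic_inv =1 id}.
Proof.
move=> x /negP xU; rewrite /padic_inv; case: xgetP => // y _ yx.
by case: xU; exact: padic_unitP yx.
Qed.

HB.instance Definition _ := GRing.ComNzRing_hasMulInverse.Build Zp
  padic_mulVr padic_unitP padic_inv_out.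

(* The p-adic valuation of x <> 0, that is, the n with p^n | x and not         *)
(* p^(n+1) | x; the value at 0 is irrelevant.                                  *)
Definition padic_val (x : Zp) : nat :=
  if pselect (exists n, residue x n.+1 != 0%N) is left ex then ex_minn ex
  else 0%N.

Lemma residue_eq0 (x : Zp) n : x != 0 ->
  (residue x n == 0%N) = (n <= padic_val x)%N.
Proof.
move=> x0; rewrite /padic_val; case: pselect => [ex|nex].
  case: ex_minnP => m xm minm; apply/idP/idP => [/eqP xn|nm].
    rewrite leqNgt; apply: contra xm => mn.
    by rewrite -(residue_mod x mn) xn mod0n.
  case: n nm => [|n] nm; first by rewrite -residue_modd modn1.
  by apply: contraLR nm => /minm; rewrite -leqNgt.
exfalso; case/eqP: x0; apply: padicIntP => m; rewrite residue0.
case: m => [|m]; first by rewrite -residue_modd modn1.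
by apply/eqP; apply: contrapT => /negP xm; apply: nex; exists m.
Qed.

Lemma padic_val_uniq (x : Zp) n :
  residue x n = 0%N -> residue x n.+1 != 0%N -> x != 0 /\ padic_val x = n.
Proof.
move=> xn xn1; have x0 : x != 0 by apply: contraNneq xn1 => ->; rewrite residue0.
split=> //; apply/eqP; rewrite eqn_leq -(residue_eq0 n x0) xn eqxx andbT.
by move: xn1; rewrite residue_eq0 // -ltnNge ltnS.
Qed.

Lemma logn_residue (x : Zp) n : x != 0 -> (padic_val x < n)%N ->
  (0 < residue x n)%N /\ logn p (residue x n) = padic_val x.
Proof.
move=> x0 vn; have xn : (0 < residue x n)%N.
  by rewrite lt0n residue_eq0 // -ltnNge.
split=> //; apply/eqP; rewrite eqn_leq -ltnS ltnNge -!pfactor_dvdn //.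
rewrite /dvdn !residue_mod // ?(ltnW vn) // !residue_eq0 //.
by rewrite leqnn andbT -ltnNge.
Qed.

Lemma padic_valM (x y : Zp) : x != 0 -> y != 0 ->
  x * y != 0 /\ padic_val (x * y) = (padic_val x + padic_val y)%N.
Proof.
move=> x0 y0; set a := padic_val x; set b := padic_val y.
have resxy n : (a < n)%N -> (b < n)%N ->
    (p ^ n %| residue x n * residue y n)%N = (n <= a + b)%N.
  move=> an bn; have [xn lx] := logn_residue x0 an.
  have [yn ly] := logn_residue y0 bn.
  by rewrite pfactor_dvdn ?muln_gt0 ?xn // lognM // lx ly.
have xyN : residue (x * y) (a + b).+1 != 0%N.
  by rewrite residueM -/(dvdn _ _) resxy ?ltnn // ltnS ?leq_addl ?leq_addr.
apply: padic_val_uniq xyN; rewrite -(residue_mod _ (leqnSn _)) residueM.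
rewrite modn_dvdm ?dvdn_exp2l //; apply/eqP; rewrite -/(dvdn _ _) expnD.
by rewrite dvdn_mul // /dvdn residue_mod ?residue_eq0 // -addnS ?leq_addr // addnS
  -addSn leq_addl.
Qed.

Fact padic_mulf_eq0 (x y : Zp) : x * y = 0 -> (x == 0) || (y == 0).
Proof.
move=> xy; case: eqVneq => //= x0; case: eqVneq => //= y0.
by case: (padic_valM x0 y0); rewrite xy eqxx.
Qed.

HB.instance Definition _ :=
  GRing.ComUnitRing_isIntegral.Build Zp padic_mulf_eq0.

(* The p-adic absolute value takes its values in p^Z or 0, so it is            *)
(* rational-valued, and Z_p and Q_p are metric spaces over rat.                *)
Definition padicInt_abs (x : Zp) : rat :=
  if x == 0 then 0 else p%:R ^- padic_val x.

Lemma padicInt_abs0 : padicInt_abs 0 = 0.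
Proof. by rewrite /padicInt_abs eqxx. Qed.

Let p_gt0 : 0 < p%:R :> rat. Proof. by rewrite ltr0n prime_gt0. Qed.

Lemma padicInt_abs_gt0 x : x != 0 -> 0 < padicInt_abs x.
Proof. by move=> x0; rewrite /padicInt_abs (negPf x0) invr_gt0 exprn_gt0. Qed.

Lemma padicInt_abs_ge0 x : 0 <= padicInt_abs x.
Proof.
by have [->|/padicInt_abs_gt0/ltW//] := eqVneq x 0; rewrite padicInt_abs0.
Qed.

Lemma padicInt_absM x y : padicInt_abs (x * y) = padicInt_abs x * padicInt_abs y.
Proof.
have [->|x0] := eqVneq x 0; first by rewrite mul0r padicInt_abs0 mul0r.
have [->|y0] := eqVneq y 0; first by rewrite mulr0 padicInt_abs0 mulr0.
have [xy0 vxy] := padic_valM x0 y0.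
by rewrite /padicInt_abs (negPf x0) (negPf y0) (negPf xy0) vxy exprD invfM.
Qed.

Lemma padicInt_abs1 : padicInt_abs 1 = 1.
Proof.
have n0 := padicInt_abs_gt0 (oner_neq0 Zp).
by apply: (mulfI (lt0r_neq0 n0)); rewrite -padicInt_absM !mulr1.
Qed.

Lemma padicInt_absN x : padicInt_abs (- x) = padicInt_abs x.
Proof.
rewrite -mulN1r padicInt_absM; suff -> : padicInt_abs (-1) = 1 by rewrite mul1r.
apply/eqP; rewrite -(@pexpr_eq1 _ _ 2) ?padicInt_abs_ge0 //.
by rewrite expr2 -padicInt_absM mulrNN mulr1 padicInt_abs1.
Qed.

Lemma padicInt_absP x n :
  (padicInt_abs x <= p%:R ^- n) = (residue x n == 0%N).
Proof.
have [->|x0] := eqVneq x 0.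
  by rewrite residue0 padicInt_abs0 invr_ge0 exprn_ge0 ?ltW // eqxx.
rewrite residue_eq0 // /padicInt_abs (negPf x0).
rewrite lef_pV2 ?posrE ?exprn_gt0 //.
by rewrite ler_eXn2l // ltr1n prime_gt1.
Qed.

Lemma padicInt_absD x y :
  padicInt_abs (x + y) <= Num.max (padicInt_abs x) (padicInt_abs y).
Proof.
wlog xy : x y / padicInt_abs x <= padicInt_abs y.
  move=> W; case/orP: (le_total (padicInt_abs x) (padicInt_abs y)) => /W //.
  by rewrite addrC maxC.
rewrite max_r //.
have [y0|y0] := eqVneq y 0; first by rewrite y0 addr0 -y0.
have ey : padicInt_abs y = p%:R ^- padic_val y by rewrite /padicInt_abs (negPf y0).
move: xy; rewrite ey !padicInt_absP residueD => /eqP ->.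
by rewrite add0n residue_modd residue_eq0.
Qed.

Fact padicInt_distxx x : padicInt_abs (x - x) = 0.
Proof. by rewrite subrr padicInt_abs0. Qed.
Fact padicInt_dist_eq0 x y : padicInt_abs (x - y) = 0 -> x = y.
Proof.
move=> /eqP; apply: contraTeq; rewrite -subr_eq0 => /padicInt_abs_gt0.
exact: lt0r_neq0.
Qed.
Fact padicInt_distC x y : padicInt_abs (x - y) = padicInt_abs (y - x).
Proof. by rewrite -padicInt_absN opprB. Qed.
Fact padicInt_distD y x z :
  padicInt_abs (x - z) <= padicInt_abs (x - y) + padicInt_abs (y - z).
Proof.
rewrite -[x - z](subrKA y) (le_trans (padicInt_absD _ _)) // ge_max.
by rewrite lerDl lerDr !padicInt_abs_ge0.
Qed.

HB.instance Definition _ := isMetric.Build rat Zp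
  padicInt_distxx padicInt_dist_eq0 padicInt_distC padicInt_distD.
HB.instance Definition _ := isPointed.Build Zp 0.

End PadicIntRing.

Definition padic (p : nat) (p_pr : prime p) : Type := {fraction padicInt p_pr}.

Section PadicField.
Variables (p : nat) (p_pr : prime p).
Local Notation Zp := (padicInt p_pr).
Local Notation Qp := (padic p_pr).

HB.instance Definition _ := GRing.Field.on Qp.

Definition padic_inj : Zp -> Qp := @FracField.tofrac Zp.
HB.instance Definition _ := GRing.RMorphism.on padic_inj.

Definition padic_abs (x : Qp) : rat :=
  let r := repr (x : {fraction Zp}) in padicInt_abs (frac r).1 / padicInt_abs (frac r).2.

Lemma padic_fracE (x : Qp) : exists n d : Zp,
  [/\ d != 0, x = padic_inj n / padic_inj d
    & padic_abs x = padicInt_abs n / padicInt_abs d].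
Proof.
pose r := repr (x : {fraction Zp}); exists (frac r).1, (frac r).2.
have d0 := denom_ratioP r; split=> //.
have inj0 : padic_inj (frac r).2 != 0 by rewrite tofrac_eq0.
apply: (mulIf inj0); rewrite mulfVK // -[x](@reprK _ {fraction Zp}) -/r.
rewrite /padic_inj; unlock FracField.tofrac.
rewrite -[LHS]FracField.pi_mul; apply/eqmodP.
rewrite /= FracField.equivfE /FracField.mulf /=.
by rewrite !numden_Ratio ?oner_neq0 ?mulf_neq0 ?oner_neq0 // mulr1 mulr1 mulrC.
Qed.

Lemma padic_absE (n d : Zp) : d != 0 ->
  padic_abs (padic_inj n / padic_inj d) = padicInt_abs n / padicInt_abs d.
Proof.
move=> d0; have [n' [d' [d'0 eq ->]]] := padic_fracE (padic_inj n / padic_inj d).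
have ad := lt0r_neq0 (padicInt_abs_gt0 d0).
have ad' := lt0r_neq0 (padicInt_abs_gt0 d'0).
move/eqP: eq; rewrite eqr_div ?tofrac_eq0 // -!rmorphM /= tofrac_eq => /eqP eq.
by apply/eqP; rewrite eqr_div // -!padicInt_absM eq.
Qed.

Lemma padic_abs_inj n : padic_abs (padic_inj n) = padicInt_abs n.
Proof.
have := padic_absE n (oner_neq0 Zp).
by rewrite rmorph1 padicInt_abs1 !divr1.
Qed.

Lemma padic_abs0 : padic_abs 0 = 0.
Proof. by rewrite -(rmorph0 padic_inj) padic_abs_inj padicInt_abs0. Qed.

Lemma padic_abs_ge0 x : 0 <= padic_abs x.
Proof. by rewrite /padic_abs divr_ge0 // padicInt_abs_ge0. Qed.

Lemma padic_abs_eq0 x : padic_abs x = 0 -> x = 0.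
Proof.
have [n [d [d0 -> ->]]] := padic_fracE x; have [->|n0] := eqVneq n 0.
  by rewrite rmorph0 mul0r.
by move/eqP; rewrite mulf_eq0 invr_eq0 !gt_eqF ?padicInt_abs_gt0.
Qed.

Lemma padic_absM x y : padic_abs (x * y) = padic_abs x * padic_abs y.
Proof.
have [n [d [d0 -> ->]]] := padic_fracE x.
have [n' [d' [d'0 -> ->]]] := padic_fracE y.
rewrite mulf_div -!rmorphM /= padic_absE ?mulf_neq0 // !padicInt_absM.
by rewrite mulf_div.
Qed.

Lemma padic_absN x : padic_abs (- x) = padic_abs x.
Proof.
have [n [d [d0 -> ->]]] := padic_fracE x.
by rewrite -mulNr -rmorphN /= padic_absE // padicInt_absN.
Qed.

Lemma padic_absD x y :
  padic_abs (x + y) <= Num.max (padic_abs x) (padic_abs y).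
Proof.
have [n [d [d0 -> ->]]] := padic_fracE x.
have [n' [d' [d'0 -> ->]]] := padic_fracE y.
rewrite addf_div ?tofrac_eq0 // -!rmorphM -rmorphD /=.
rewrite padic_absE ?mulf_neq0 //.
have ad := padicInt_abs_gt0 d0; have ad' := padicInt_abs_gt0 d'0.
rewrite padicInt_absM ler_pdivrMr ?mulr_gt0 //.
rewrite maxr_pMl ?mulr_ge0 ?padicInt_abs_ge0 //.
rewrite mulrA divfK ?lt0r_neq0 // mulrCA divfK ?lt0r_neq0 //.
by rewrite (mulrC (padicInt_abs d)) -!padicInt_absM padicInt_absD.
Qed.

Fact padic_distxx x : padic_abs (x - x) = 0.
Proof. by rewrite subrr padic_abs0. Qed.
Fact padic_dist_eq0 x y : padic_abs (x - y) = 0 -> x = y.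
Proof. by move/padic_abs_eq0/eqP; rewrite subr_eq0 => /eqP. Qed.
Fact padic_distC x y : padic_abs (x - y) = padic_abs (y - x).
Proof. by rewrite -padic_absN opprB. Qed.
Fact padic_distD y x z :
  padic_abs (x - z) <= padic_abs (x - y) + padic_abs (y - z).
Proof.
rewrite -[x - z](subrKA y) (le_trans (padic_absD _ _)) // ge_max.
by rewrite lerDl lerDr !padic_abs_ge0.
Qed.

HB.instance Definition _ := isMetric.Build rat Qp
  padic_distxx padic_dist_eq0 padic_distC padic_distD.
HB.instance Definition _ := isPointed.Build Qp 0.

End PadicField.

Notation "x %:Qp" := (padic_inj x)
  (at level 1, left associativity, format "x %:Qp") : ring_scope.

Section IncompleteGamma.
Variables (p : nat) (p_pr : prime p).
Local Notation Zp := (padicInt p_pr).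
Local Notation Qp := (padic p_pr).

(* The continuous g : Z_p -> T with g n = u n for all natural numbers n        *)
(* satisfying D (unique as soon as D is dense in Z_p and T is Hausdorff); an   *)
(* arbitrary function when there is none.                                      *)
Definition padic_interpolation (T : ptopologicalType) (D : pred nat)
    (u : nat -> T) : Zp -> T :=
  get [set g : Zp -> T | continuous g /\ forall n, D n -> g n%:R = u n].

Definition morita_gamma : Zp -> Zp :=
  padic_interpolation (fun n => 0 < n)%N
    (fun n => (-1) ^+ n * \prod_(1 <= k < n | ~~ (p %| k)%N) k%:R : Zp).

Definition padic_exp (x : Qp) : Qp :=
  limn (series (fun n => x ^+ n / n`!%:R)).

Definition one_units : set Zp := [set z | exists a : Zp, z = 1 + p%:R * a].

(* z ^ s for z in 1 + p Z_p *)
Definition padic_pow (z s : Zp) : Zp :=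
  padic_interpolation predT (fun n => z ^+ n : Zp) s.

(* \sum_(k = 0)^(s - 1) z ^ k / Gamma_p(k + 1) for s in Z_p *)
Definition gamma_sum (z s : Zp) : Qp :=
  padic_interpolation (fun n => 0 < n)%N
    (fun n =>
       \sum_(0 <= k < n) (z ^+ k)%:Qp / (morita_gamma k.+1%:R)%:Qp : Qp) s.

Definition incomplete_gamma (s z : Zp) : Qp :=
  padic_exp (p%:R * z%:Qp) * (morita_gamma s)%:Qp * gamma_sum z s.

(* h_p; the elements of Z_p that are not units are those of p Z_p. *)
Definition gamma_factor (s : Zp) : Zp :=
  if s \is a GRing.unit then - s else -1.

(* Functions on Z_p x (1 + p Z_p) are represented by total functions on        *)
(* Z_p x Z_p, of which only the restriction to this set matters.               *)
Definition gamma_domain : set (Zp * Zp) := [set: Zp] `*` one_units.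

Definition incomplete_gamma_eqs (f : Zp -> Zp -> Qp) : Prop :=
  (forall z, one_units z -> f 1 z = padic_exp (p%:R * z%:Qp)) /\
  (forall s z, one_units z ->
     f (s + 1) z = (gamma_factor s)%:Qp * f s z
                   + (padic_pow z s)%:Qp * padic_exp (p%:R * z%:Qp)).

End IncompleteGamma.

Arguments incomplete_gamma {p p_pr}.
Arguments gamma_domain {p} p_pr _.

(* Main.v *)
(* All the functions involved take values in Z_p up to the embedding in Q_p,
   and continuity is reduced to congruences modulo powers of p. A function u on
   the natural numbers such that a = b mod p^(2n) implies u a = u b mod p^n
   extends continuously to Z_p. For Gamma_p this is the generalized Wilson
   theorem: the product of the k < p^n prime to p is -1 mod p^n. If f is
   p^n-periodic mod p^n for all n, then its partial sums extend as well, because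
   the sum of f over p^(2n) consecutive integers is p^n times a sum over one
   period; applied to f k = z^k / Gamma_p(k+1), whose values mod p^n only depend
   on z mod p^n, this gives joint continuity. The functional equation and the
   uniqueness are checked on the positive integers, which are dense in Z_p. *)
Require Import Defs.
From mathcomp Require Import all_boot all_order all_algebra.
From mathcomp Require Import all_classical all_reals all_analysis.
From mathcomp Require Import ring zify.
Import Order.TTheory GRing.Theory Num.Theory.
Local Open Scope classical_set_scope.
Local Open Scope ring_scope.

Set Implicit Arguments.
Unset Strict Implicit.
Unset Printing Implicit Defensive.

(** * Congruences modulo powers of p in Z_p *)

Section Congruence.
Variables (p : nat) (p_pr : prime p).
Local Notation Zp := (padicInt p_pr).
Implicit Types x y z : Zp.

Lemma residue_expn0 x : residue x 0 = 0%N.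
Proof. by rewrite -residue_modd modn1. Qed.

Lemma residueB_eq0 x y n :
  (residue (x - y) n == 0%N) = (residue x n == residue y n).
Proof.
apply/eqP/eqP => [xy|xy].
  by rewrite -[x](subrK y) residueD xy add0n residue_modd.
by rewrite residueD xy -residueD subrr residue0.
Qed.

Lemma residue_congrD n x x' y y' : residue x n = residue x' n ->
  residue y n = residue y' n -> residue (x + y) n = residue (x' + y') n.
Proof. by rewrite !residueD => -> ->. Qed.

Lemma residue_congrM n x x' y y' : residue x n = residue x' n ->
  residue y n = residue y' n -> residue (x * y) n = residue (x' * y') n.
Proof. by rewrite !residueM => -> ->. Qed.

Lemma residue_congrN n x x' : residue x n = residue x' n ->
  residue (- x) n = residue (- x') n.
Proof. by move=> xx'; rewrite -mulN1r -[- x']mulN1r; exact: residue_congrM. Qed.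

Lemma residue_congrX n k x x' : residue x n = residue x' n ->
  residue (x ^+ k) n = residue (x' ^+ k) n.
Proof.
by move=> xx'; elim: k => // k IH; rewrite !exprS; exact: residue_congrM.
Qed.

Lemma residue_congr_sum (I : Type) (r : seq I) n (f g : I -> Zp) :
  (forall i, residue (f i) n = residue (g i) n) ->
  residue (\sum_(i <- r) f i) n = residue (\sum_(i <- r) g i) n.
Proof.
by move=> fg; elim/big_rec2: _ => // i x y _ xy; exact: residue_congrD.
Qed.

Lemma residue_congr_prod (I : Type) (r : seq I) n (f g : I -> Zp) :
  (forall i, residue (f i) n = residue (g i) n) ->
  residue (\prod_(i <- r) f i) n = residue (\prod_(i <- r) g i) n.
Proof.
by move=> fg; elim/big_rec2: _ => // i x y _ xy; exact: residue_congrM.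
Qed.

Lemma residue_congr_le m n x y : (m <= n)%N ->
  residue x n = residue y n -> residue x m = residue y m.
Proof. by move=> mn xy; rewrite -(residue_mod _ mn) xy residue_mod. Qed.

Lemma residue_congr_nat n a b : a = b %[mod p ^ n] ->
  residue (a%:R : Zp) n = residue (b%:R : Zp) n.
Proof. by rewrite !residue_nat. Qed.

Lemma residue_mul_eq0 m n x y : residue x m = 0%N -> residue y n = 0%N ->
  residue (x * y) (m + n) = 0%N.
Proof.
move=> /eqP; rewrite -padicInt_absP => xm /eqP; rewrite -padicInt_absP => yn.
apply/eqP; rewrite -padicInt_absP padicInt_absM exprD invfM.
by rewrite ler_pM ?padicInt_abs_ge0.
Qed.

Lemma residue_mull_eq0 n x y : residue x n = 0%N -> residue (x * y) n = 0%N.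
Proof. by rewrite residueM => ->; rewrite mod0n. Qed.

Lemma residue_pX n : residue ((p ^ n)%:R : Zp) n = 0%N.
Proof. by rewrite residue_nat modnn. Qed.

(** In $x^p-y^p=(x-y)\sum_i x^{p-1-i}y^i$ the p summands are all congruent to $y^{p-1}$ mod p, so
    the second factor contributes one more p. *)
Lemma residue_congr_expp n x y : (0 < n)%N -> residue x n = residue y n ->
  residue (x ^+ p) n.+1 = residue (y ^+ p) n.+1.
Proof.
move=> n0 xy; apply/eqP; rewrite -residueB_eq0 subrXX -addn1; apply/eqP.
apply: residue_mul_eq0; first by apply/eqP; rewrite residueB_eq0 xy.
have xy1 : residue x 1 = residue y 1 by exact: residue_congr_le xy.
rewrite (@residue_congr_sum _ _ _ _ (fun=> y ^+ p.-1)); last first.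
  move=> [i ip] /=; rewrite [in RHS](_ : p.-1 = p.-1 - i + i)%N.
    by rewrite exprD; apply: residue_congrM => //; exact: residue_congrX.
  by rewrite subnK// -ltnS prednK// prime_gt0.
by rewrite sumr_const card_ord -mulr_natl residue_mull_eq0// residue_nat expn1 modnn.
Qed.

Lemma residue_congr_exppX n x y : residue x 1 = residue y 1 ->
  residue (x ^+ (p ^ n)) n.+1 = residue (y ^+ (p ^ n)) n.+1.
Proof.
move=> xy; elim: n => [|n IH]; first by rewrite !expr1.
by rewrite expnSr !exprM; exact: residue_congr_expp.
Qed.

(** Completeness of Z_p for sequences whose n-th term is significant only mod p^n. *)
Lemma padic_lim_ex (v : nat -> Zp) :
  (forall n, residue (v n.+1) n = residue (v n) n) ->
  exists x, forall n, residue x n = residue (v n) n.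
Proof.
move=> vP.
have uP n : residue (v n.+1) n.+1 = residue (v n) n %[mod p ^ n].
  by rewrite residueP residue_modd vP.
by exists (padic_of p_pr uP) => n /=; rewrite residue_modd.
Qed.

(** Bezout gives an inverse [u n] of x modulo each p^n; [padic_lim_ex] glues these inverses. *)
Lemma padic_unitE x : (x \is a GRing.unit) = (residue x 1 != 0%N).
Proof.
apply/idP/idP => [ux|x1].
  apply/negP => /eqP /(@residue_mull_eq0 _ _ x^-1).
  by rewrite mulrV// residue1 modn_small// expn1 prime_gt1.
have cop n : coprime (residue x n) (p ^ n).
  case: n => [|n]; first by rewrite coprimen1.
  rewrite coprime_sym coprimeXl// prime_coprime//; move: x1; apply: contra => px.
  by rewrite -(@residue_mod _ _ x 1 n.+1)// expn1.
pose u n := (egcdn (residue x n) (p ^ n)).1.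
have uP n : (u n * residue x n = 1 %[mod p ^ n])%N.
  case: n => [|n]; first by rewrite !modn1.
  rewrite /u; have x0 : (0 < residue x n.+1)%N.
    rewrite lt0n; apply: contra x1 => /eqP x0.
    by rewrite -(@residue_mod _ _ x 1 n.+1)// x0 mod0n.
  case: egcdnP => //= km kn -> _; move: (cop n.+1); rewrite /coprime => /eqP ->.
  by rewrite modnMDl.
have [y yP] : exists y : Zp, forall n, residue y n = residue ((u n)%:R : Zp) n.
  apply: padic_lim_ex => n.
  have h1 : residue ((u n.+1)%:R * x) n = residue (1 : Zp) n.
    apply: (@residue_congr_le n n.+1) => //.
    by rewrite residueM residue_nat modnMml residue1 uP.
  have h2 : residue ((u n)%:R * x) n = residue (1 : Zp) n.
    by rewrite residueM residue_nat modnMml residue1 uP.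
  (* Inverses mod p^n are unique: both sides equal [u n.+1 * u n * x] mod p^n. *)
  transitivity (residue ((u n.+1)%:R * ((u n)%:R * x)) n).
    by rewrite -[in LHS](mulr1 (u n.+1)%:R); exact: residue_congrM.
  by rewrite mulrCA -[in RHS](mulr1 (u n)%:R); exact: residue_congrM.
apply: (@padic_unitP _ p_pr x y); apply: padicIntP => n.
by rewrite residueM yP residue_nat modnMml uP.
Qed.

Lemma residue_congrV n x y : x \is a GRing.unit -> y \is a GRing.unit ->
  residue x n = residue y n -> residue x^-1 n = residue y^-1 n.
Proof.
move=> ux uy xy; apply/eqP; rewrite -residueB_eq0.
rewrite (_ : x^-1 - y^-1 = (y - x) * (x^-1 * y^-1)); last first.
  by rewrite mulrBl [y * _]mulrC divrK// mulrA divrr// mul1r.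
by rewrite residue_mull_eq0//; apply/eqP; rewrite residueB_eq0 xy.
Qed.

End Congruence.

(** * Periodic functions and arithmetic progressions *)

Lemma eq_mod_periodic (T : Type) (g : nat -> T) q :
  (forall k, g (k + q)%N = g k) -> forall a b, a = b %[mod q] -> g a = g b.
Proof.
move=> gq; suff gmod a : g a = g (a %% q)%N by move=> a b ab; rewrite gmod ab -gmod.
rewrite {1}(divn_eq a q) addnC; elim: (a %/ q)%N => [|m IH]; first by rewrite addn0.
by rewrite mulSn addnCA addnC gq.
Qed.

(** Sliding the window by one replaces [f n] by [f (n + q)]. The map [r] stands for reduction mod
    p^n, and [op] for addition or multiplication. *)
Lemma big_window (R T : Type) (idx : R) (op : Monoid.com_law idx) (r : R -> T)
    (f : nat -> R) q :
  (forall x y y', r y = r y' -> r (op x y) = r (op x y')) ->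
  (forall k, r (f (k + q)%N) = r (f k)) ->
  forall n, r (\big[op/idx]_(n <= k < n + q) f k) =
            r (\big[op/idx]_(0 <= k < q) f k).
Proof.
move=> rop fq; elim=> [|n <-] //; case: q fq => [|q] fq.
  by rewrite !addn0 !big_geq.
rewrite [in LHS]addnS big_nat_recr ?leq_addr//= [in RHS]big_ltn; last first.
  by rewrite -addSnnS leq_addr.
rewrite addSnnS [in RHS]Monoid.mulmC; exact: rop.
Qed.

(** Expansion mod $q^2$: the coefficient of q is $x^{m-1}$ times $0+1+\dots+(m-1)$. For m = 0 the
    truncated [m.-1] is harmless, as the binomial vanishes. *)
Lemma prod_arith_progression (R : comNzRingType) (x q : R) m : exists c,
  \prod_(0 <= j < m) (x + j%:R * q) =
  x ^+ m + 'C(m, 2)%:R * q * x ^+ m.-1 + q ^+ 2 * c.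
Proof.
elim: m => [|m [c IH]].
  by exists 0; rewrite big_geq// bin0n !mul0r mulr0 !addr0.
rewrite big_nat_recr//= IH binS bin1 natrD.
case: m {IH} => [|m] /=.
  by exists (c * x); rewrite bin0n mulr0n !mul0r ?addr0 expr0 expr1 mulrDl
    !mul1r ?mul0r ?addr0 mulrA.
set b := 'C(_, _)%:R; set a := m.+1%:R.
exists (b * x ^+ m * a + c * (x + a * q)); rewrite !exprS.
ring.
Qed.

(** * The generalized Wilson theorem and Gamma_p on the natural numbers *)

Section Wilson.
Variables (p : nat) (p_pr : prime p) (p_odd : odd p).
Local Notation Zp := (padicInt p_pr).

(* Replacing the multiples of p by 1 makes the product of Gamma_p a product
   over all the integers of an interval, of a function that is p^n-periodic
   mod p^n. *)
Definition prime_to_p k : Zp := if (p %| k)%N then 1 else k%:R.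

Lemma prime_to_p_periodic n k :
  residue (prime_to_p (k + p ^ n)) n = residue (prime_to_p k) n.
Proof.
case: n => [|n]; first by rewrite !residue_expn0.
rewrite /prime_to_p dvdn_addl ?expnS ?dvdn_mulr//; case: ifP => // _.
by rewrite -expnS; apply: residue_congr_nat; rewrite modnDr.
Qed.

Lemma prod_prime_to_p_p :
  residue (\prod_(0 <= k < p) prime_to_p k) 1 = residue (-1 : Zp) 1.
Proof.
have -> : \prod_(0 <= k < p) prime_to_p k = (p.-1)`!%:R.
  have p0 := prime_gt0 p_pr.
  rewrite fact_prod prednK// natr_prod big_ltn// {1}/prime_to_p dvdn0 mul1r.
  by apply: eq_big_nat => k /andP[k0 kp]; rewrite /prime_to_p gtnNdvd.
have := Wilson (prime_gt1 p_pr); rewrite p_pr => /esym; rewrite /dvdn => /eqP w.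
apply/eqP; rewrite -residueB_eq0 opprK natr1 residue_nat expn1; exact/eqP.
Qed.

(** Induction from Wilson's theorem. With $q=p^{n+1}$, split $[0,pq)$ into p blocks of length q: for
    each k prime to p the product of the k + iq is $k^p$ mod pq. The whole product is thus the p-th
    power of the previous one, and p-th powers refine the congruence with -1 by one factor p. *)
Lemma prod_prime_to_p n :
  residue (\prod_(0 <= k < p ^ n) prime_to_p k) n = residue (-1 : Zp) n.
Proof.
case: n => [|n]; first by rewrite !residue_expn0.
elim: n => [|n IH]; first by rewrite expn1 prod_prime_to_p_p.
set q := (p ^ n.+1)%N; have -> : (-1 : Zp) = (-1) ^+ p.
  by rewrite -signr_odd p_odd.
rewrite -(residue_congr_expp _ IH)// -prodrXl expnSr -/q mulnC big_nat_mul.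
rewrite (eq_big_nat _ _ (F2 := fun i =>
  \prod_(0 <= k < q) prime_to_p (k + i * q)%N)); last first.
  by move=> i _; rewrite -{1}[(i * q)%N]add0n big_addn mulSn addnK.
rewrite exchange_big_nat; apply: residue_congr_prod => k.
have pq m : (p %| m * q)%N by rewrite /q expnS dvdn_mull// dvdn_mulr.
rewrite /prime_to_p; case: ifP => pk.
  rewrite expr1n big1// => i _; by rewrite dvdn_addl// pk.
rewrite (eq_bigr (fun i => k%:R + i%:R * q%:R)) => [|i _]; last first.
  by rewrite dvdn_addl// pk natrD natrM.
(* The linear term vanishes mod pq because p divides ['C(p, 2)] for odd p, the quadratic one because
   pq divides $q^2$. *)
have [c ->] := prod_arith_progression k%:R (q%:R : Zp) p.
rewrite -[RHS](congr1 (fun x => residue x _) (addr0 _)) -addrA.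
apply: residue_congrD => //; rewrite residue0.
have q0 : residue (q%:R : Zp) n.+1 = 0%N by exact: residue_pX.
have p2 := odd_prime_gt2 p_odd p_pr.
have b0 : residue ('C(p, 2)%:R : Zp) 1 = 0%N.
  by rewrite residue_nat expn1; apply/eqP; exact: prime_dvd_bin.
rewrite -[RHS](residue0 p_pr n.+2) -[in RHS](addr0 0).
apply: residue_congrD; rewrite residue0.
  by apply: residue_mull_eq0; exact: (residue_mul_eq0 b0).
apply: residue_mull_eq0; rewrite expr2 -[RHS](residue0 p_pr n.+2).
apply: (@residue_congr_le _ _ _ (n.+1 + n.+1)); first by rewrite addnS ltnS leq_addr.
by rewrite residue0; exact: residue_mul_eq0.
Qed.

(** Starting at k = 0, where the factor is 1, makes $[0,p^n)$ a full period of [prime_to_p]. *)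
Definition gamma_nat n : Zp := (-1) ^+ n * \prod_(0 <= k < n) prime_to_p k.

Lemma gamma_natE n :
  gamma_nat n = (-1) ^+ n * \prod_(1 <= k < n | ~~ (p %| k)%N) k%:R.
Proof.
congr (_ * _); case: n => [|n]; first by rewrite !big_geq.
rewrite big_ltn// {1}/prime_to_p dvdn0 mul1r [RHS]big_mkcond /=.
by apply: eq_bigr => k _; rewrite /prime_to_p; case: ifP.
Qed.

Lemma gamma_natS n : gamma_nat n.+1 = - prime_to_p n * gamma_nat n.
Proof. by rewrite /gamma_nat big_nat_recr//= exprS mulN1r !mulNr; congr (- _); ring. Qed.

Lemma gamma_nat_unit n : gamma_nat n \is a GRing.unit.
Proof.
elim: n => [|n IH]; first by rewrite /gamma_nat big_geq// mulr1 unitr1.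
rewrite gamma_natS unitrM IH andbT unitrN /prime_to_p.
case: ifPn => [|pn]; first by rewrite unitr1.
by rewrite padic_unitE residue_nat expn1.
Qed.

(** The sign $(-1)^{p^M}=-1$ cancels the -1 of the generalized Wilson theorem. *)
Lemma gamma_nat_periodic M n :
  residue (gamma_nat (n + p ^ M)) M = residue (gamma_nat n) M.
Proof.
rewrite /gamma_nat exprD -(signr_odd _ (p ^ M)) oddX p_odd orbT expr1.
rewrite (big_cat_nat (n := n)) ?leq_addr// -!mulrA; apply: residue_congrM => //.
rewrite mulrCA -[in RHS](mulr1 (\prod_(_ <= _ < _) _)); apply: residue_congrM => //.
rewrite mulN1r -[in RHS](opprK 1); apply: residue_congrN.
rewrite -prod_prime_to_p; apply: (big_window (r := fun x : Zp => residue x M)).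
  by move=> x y y'; exact: residue_congrM.
exact: prime_to_p_periodic.
Qed.

End Wilson.

(** * The topology of Z_p and extension by continuity *)

Section Topology.
Variables (p : nat) (p_pr : prime p).
Local Notation Zp := (padicInt p_pr).
Local Notation Qp := (padic p_pr).

Lemma nbhs_padicP (x : Zp) (A : set Zp) :
  nbhs x A <-> exists n, forall y, residue y n = residue x n -> A y.
Proof.
have absP (y : Zp) n :
    (padicInt_abs (x - y) <= p%:R ^- n) = (residue y n == residue x n).
  by rewrite padicInt_absP residueB_eq0 eq_sym.
rewrite -nbhs_ballE; split=> [[e /= e0 xeA]|[n nA]].
  have p1 : 1 < p%:R :> rat by rewrite ltr1n prime_gt1.
  have [n en] : exists n, p%:R ^- n < e.
    (* This n exceeds 1/e, and p^n exceeds n. *)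
    exists (Num.truncn e^-1).+1; rewrite -[ltRHS]invrK.
    rewrite ltf_pV2 ?posrE ?invr_gt0 ?exprn_gt0//; last first.
      exact: lt_trans p1.
    apply: (lt_le_trans (truncnS_gt _)); rewrite -natrX ler_nat.
    by rewrite ltnW// ltn_expl// prime_gt1.
  exists n => y yx; apply: xeA; rewrite ballEmdist /=.
  by apply: le_lt_trans en; rewrite absP yx.
exists (p%:R ^- n) => /=.
  by rewrite invr_gt0 exprn_gt0// ltr0n prime_gt0.
move=> y; rewrite ballEmdist /= => /ltW; rewrite absP => /eqP; exact: nA.
Qed.

Lemma padic_inj_continuous : continuous (@padic_inj p p_pr).
Proof.
move=> x A /nbhs_ballP[e /= e0 eA].
apply: filterS (nbhsx_ballx x _ e0) => y xy; apply: eA; move: xy.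
by rewrite !ballEmdist /= /mdist /= -rmorphB /= padic_abs_inj.
Qed.

Lemma eq_continuous_padic (T : topologicalType) (f g : Zp -> T) :
  hausdorff_space T -> continuous f -> continuous g ->
  (forall n, (0 < n)%N -> f n%:R = g n%:R) -> f = g.
Proof.
move=> hT cf cg fg; apply/funext => x; apply: hT => A B fxA gxB.
have /nbhs_padicP[n nAB] : nbhs x (f @^-1` A `&` g @^-1` B).
  by apply: filterI; [exact: cf | exact: cg].
(* Adding p^n keeps the class of x and makes the representative positive even when the residue is
   0. *)
have xn : residue ((residue x n + p ^ n)%:R : Zp) n = residue x n.
  by rewrite residue_nat modnDr residue_modd.
have [fA gB] := nAB _ xn; exists (f (residue x n + p ^ n)%:R); split => //.
by rewrite fg// ltn_addl// expn_gt0 prime_gt0.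
Qed.

(** The exponent 2n, instead of n, accommodates partial sums. *)
Definition padic_holder (u : nat -> Zp) :=
  forall n a b, a = b %[mod p ^ n.*2] -> residue (u a) n = residue (u b) n.

Lemma padic_holder_periodic (u : nat -> Zp) :
  (forall n k, residue (u (k + p ^ n.*2)%N) n = residue (u k) n) ->
  padic_holder u.
Proof.
by move=> uP n; apply: (eq_mod_periodic (g := fun k => residue (u k) n)).
Qed.

(** For u satisfying [padic_holder] the set is a singleton; [get] makes the extension total in u. *)
Definition padic_ext (u : nat -> Zp) (s : Zp) : Zp :=
  get [set x | forall n, residue x n = residue (u (residue s n.*2)) n].

Section Extension.
Variables (u : nat -> Zp) (uP : padic_holder u).

Lemma residue_ext s n : residue (padic_ext u s) n = residue (u (residue s n.*2)) n.
Proof.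
have [|x xP] := @padic_lim_ex _ p_pr (fun n => u (residue s n.*2)).
  move=> m; apply: uP; rewrite residue_modd residue_mod// leq_double//.
by rewrite /padic_ext; case: xgetP => [_ -> /(_ n)//|/(_ x)].
Qed.

Lemma residue_congr_ext s t n :
  residue s n.*2 = residue t n.*2 ->
  residue (padic_ext u s) n = residue (padic_ext u t) n.
Proof. by rewrite !residue_ext => ->. Qed.

Lemma padic_ext_nat k : padic_ext u k%:R = u k.
Proof.
apply: padicIntP => n; rewrite residue_ext residue_nat; apply: uP.
by rewrite modn_mod.
Qed.

Lemma padic_ext_continuous : continuous (padic_ext u).
Proof.
move=> s A /nbhs_padicP[n nA]; apply/nbhs_padicP; exists n.*2 => t ts.
by apply: nA; exact: residue_congr_ext.
Qed.

(** The explicit extension shows that an interpolation exists, and density of the positive integers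
    identifies it with the chosen one. The map [h] is the identity or the embedding in Q_p. *)
Lemma padic_interpolationE (T : ptopologicalType) (D : pred nat) (h : Zp -> T)
    (v : nat -> T) :
  hausdorff_space T -> continuous h -> (forall n, (0 < n)%N -> D n) ->
  (forall n, D n -> v n = h (u n)) ->
  padic_interpolation D v = h \o padic_ext u.
Proof.
move=> hT ch D0 vu.
have cu : continuous (h \o padic_ext u).
  by move=> s; apply: continuous_comp; [exact: padic_ext_continuous | exact: ch].
rewrite /padic_interpolation; case: xgetP => [g _ [cg gv]|/(_ (h \o padic_ext u))[]].
  apply: eq_continuous_padic => // n n0.
  by rewrite gv ?D0// vu ?D0//= padic_ext_nat.
by split=> // n Dn /=; rewrite padic_ext_nat vu.
Qed.

End Extension.
End Topology.

(** * Uniform continuity by congruences; partial sums and powers *)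

Section UniformContinuity.
Variables (p : nat) (p_pr : prime p).
Local Notation Zp := (padicInt p_pr).

Definition padic_ucont (f : Zp -> Zp) := forall n, exists m, forall s t,
  residue s m = residue t m -> residue (f s) n = residue (f t) n.

Lemma padic_ucont_continuous f : padic_ucont f -> continuous f.
Proof.
move=> fu s A /nbhs_padicP[n nA]; have [m fm] := fu n.
by apply/nbhs_padicP; exists m => t ts; apply: nA; exact: fm.
Qed.

Lemma padic_ucont_id : padic_ucont id.
Proof. by move=> n; exists n. Qed.

Lemma padic_ucont_cst c : padic_ucont (fun=> c).
Proof. by move=> n; exists 0%N. Qed.

Lemma padic_ucont_comp f g : padic_ucont f -> padic_ucont g -> padic_ucont (f \o g).
Proof.
move=> fu gu n; have [m fm] := fu n; have [k gk] := gu m.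
by exists k => s t st; apply: fm; exact: gk.
Qed.

Lemma padic_ucont2 (op : Zp -> Zp -> Zp) f g :
  (forall n x x' y y',
     residue x n = residue x' n -> residue y n = residue y' n ->
     residue (op x y) n = residue (op x' y') n) ->
  padic_ucont f -> padic_ucont g -> padic_ucont (fun s => op (f s) (g s)).
Proof.
move=> opP fu gu n; have [m fm] := fu n; have [k gk] := gu n.
exists (maxn m k) => s t st; apply: opP; [apply: fm|apply: gk];
  by apply: residue_congr_le st; rewrite ?leq_maxl ?leq_maxr.
Qed.

Lemma padic_ucontD f g : padic_ucont f -> padic_ucont g ->
  padic_ucont (fun s => f s + g s).
Proof. by apply: padic_ucont2 => *; exact: residue_congrD. Qed.

Lemma padic_ucontM f g : padic_ucont f -> padic_ucont g ->
  padic_ucont (fun s => f s * g s).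
Proof. by apply: padic_ucont2 => *; exact: residue_congrM. Qed.

Lemma padic_ucont_ext u : padic_holder u -> padic_ucont (padic_ext u : Zp -> Zp).
Proof. by move=> uP n; exists n.*2 => s t; exact: residue_congr_ext. Qed.

Lemma padic_ucont_gamma_factor : padic_ucont (@gamma_factor p p_pr).
Proof.
(* Being a unit is decided mod p, so one digit of s must be known even for n = 0. *)
move=> n; exists n.+1 => s t st; rewrite /gamma_factor !padic_unitE.
rewrite (residue_congr_le (ltn0Sn n) st); case: ifP => // _; apply: residue_congrN.
exact: residue_congr_le st.
Qed.

Lemma eq_padic_ucont f g : padic_ucont f -> padic_ucont g ->
  (forall n, (0 < n)%N -> f n%:R = g n%:R) -> f = g.
Proof.
move=> fu gu; apply: eq_continuous_padic; last 2 first.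
- exact: padic_ucont_continuous.
- exact: padic_ucont_continuous.
exact: metric_hausdorff.
Qed.

Lemma padic_holderW (u : nat -> Zp) :
  (forall n k, residue (u (k + p ^ n)%N) n = residue (u k) n) -> padic_holder u.
Proof.
move=> uP n a b ab.
apply: (eq_mod_periodic (g := fun k => residue (u k) n) (uP n)).
have dv : (p ^ n %| p ^ n.*2)%N by rewrite dvdn_exp2l// -addnn leq_addl.
by rewrite -(modn_dvdm a dv) ab modn_dvdm.
Qed.

(* Modulo p^n, a block of p^(2n) terms consists of p^n copies of the same
   period, so that its sum vanishes. *)
Lemma padic_holder_sum (f : nat -> Zp) :
  (forall n k, residue (f (k + p ^ n)%N) n = residue (f k) n) ->
  padic_holder (fun m => \sum_(0 <= k < m) f k).
Proof.
move=> fP; apply: padic_holder_periodic => n k.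
rewrite (big_cat_nat (n := k)) ?leq_addr//.
rewrite -[RHS](congr1 (fun x : Zp => residue x n) (addr0 _)).
apply: residue_congrD => //; rewrite residue0.
have addP (x y y' : Zp) : residue y n = residue y' n ->
    residue (x + y) n = residue (x + y') n.
  exact: residue_congrD.
have f2P j : residue (f (j + p ^ n.*2)%N) n = residue (f j) n.
  apply: (eq_mod_periodic (g := fun k => residue (f k) n) (fP n)).
  by rewrite -addnn expnD addnC modnMDl.
rewrite (big_window (r := fun x : Zp => residue x n) addP f2P).
rewrite -addnn expnD big_nat_mul.
transitivity (residue (\sum_(0 <= i < p ^ n) \sum_(0 <= j < p ^ n) f j) n).
  apply: residue_congr_sum => i.
  by rewrite mulSnr (big_window (r := fun x : Zp => residue x n) addP).
rewrite sumr_const_nat subn0 -mulr_natl; apply: residue_mull_eq0.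
exact: residue_pX.
Qed.

Lemma one_units_residue (z : Zp) : one_units z -> residue z 1 = residue (1 : Zp) 1.
Proof.
case=> a ->; apply/eqP; rewrite -residueB_eq0 addrAC subrr add0r residue_mull_eq0//.
by rewrite residue_nat expn1 modnn.
Qed.

(** Since z = 1 mod p, iterated p-th powers give $z^{p^n}=1$ mod $p^{n+1}$. *)
Lemma one_units_exp_periodic (z : Zp) : one_units z ->
  forall n k, residue (z ^+ (k + p ^ n)) n = residue (z ^+ k) n.
Proof.
move=> /one_units_residue z1 n k; rewrite exprD -[in RHS](mulr1 (z ^+ k)).
apply: residue_congrM => //; rewrite -(expr1n _ (p ^ n)).
by apply: (@residue_congr_le _ _ n n.+1) => //; exact: residue_congr_exppX.
Qed.

End UniformContinuity.

(** * Morita's gamma function, its sums and their recurrence *)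

Section Gamma.
Variables (p : nat) (p_pr : prime p) (p_odd : odd p).
Local Notation Zp := (padicInt p_pr).

Lemma gamma_nat_holder : padic_holder (gamma_nat p_pr).
Proof. by apply: padic_holderW; exact: gamma_nat_periodic. Qed.

Lemma morita_gammaE : @morita_gamma p p_pr = padic_ext (gamma_nat p_pr).
Proof.
apply: (padic_interpolationE gamma_nat_holder (h := id)) => //.
- exact: metric_hausdorff.
- by move=> x; exact: cvg_id.
- by move=> n _; rewrite gamma_natE.
Qed.

Lemma morita_gamma_nat n : morita_gamma n%:R = gamma_nat p_pr n.
Proof. by rewrite morita_gammaE padic_ext_nat//; exact: gamma_nat_holder. Qed.

Lemma padic_powE (z : Zp) : one_units z -> padic_pow z = padic_ext (fun n => z ^+ n).
Proof.
move=> z1; apply/funext => s; rewrite /padic_pow.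
rewrite (padic_interpolationE (u := fun n => z ^+ n) _ (h := id))//.
- by apply: padic_holderW; exact: one_units_exp_periodic.
- exact: metric_hausdorff.
- by move=> x; exact: cvg_id.
Qed.

(** The values of [gamma_nat] are units, so the division already takes place in Z_p. *)
Definition gamma_sum_nat (z : Zp) n : Zp :=
  \sum_(0 <= k < n) z ^+ k * (gamma_nat p_pr k.+1)^-1.

Lemma gamma_sum_nat_holder z : one_units z -> padic_holder (gamma_sum_nat z).
Proof.
move=> z1; apply: padic_holder_sum => n k; apply: residue_congrM.
  exact: one_units_exp_periodic.
by apply: residue_congrV; rewrite ?gamma_nat_unit// -addSn gamma_nat_periodic.
Qed.

Lemma gamma_sumE z : one_units z ->
  gamma_sum z = fun s => (padic_ext (gamma_sum_nat z) s)%:Qp.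
Proof.
move=> z1; apply/funext => s; rewrite /gamma_sum.
rewrite (padic_interpolationE (gamma_sum_nat_holder z1) (h := @padic_inj p p_pr))//.
- exact: metric_hausdorff.
- exact: padic_inj_continuous.
move=> n _; rewrite rmorph_sum; apply: eq_bigr => k _.
by rewrite morita_gamma_nat rmorphM rmorphV ?gamma_nat_unit.
Qed.

Lemma gamma_factor_nat n : gamma_factor n%:R = - prime_to_p p_pr n.
Proof.
rewrite /gamma_factor padic_unitE residue_nat expn1 /prime_to_p.
by rewrite -/(dvdn p n); case: dvdn.
Qed.

(** This is the functional equation divided by exp_p(pz). Both sides are uniformly continuous in s,
    so positive integers suffice. *)
Lemma morita_gamma_sumS z : one_units z -> forall s,
  morita_gamma (s + 1) * padic_ext (gamma_sum_nat z) (s + 1) =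
  gamma_factor s * (morita_gamma s * padic_ext (gamma_sum_nat z) s) + padic_pow z s.
Proof.
move=> z1; have Suc := gamma_sum_nat_holder z1.
have zuc : padic_holder (fun n => z ^+ n).
  by apply: padic_holderW; exact: one_units_exp_periodic.
have guc := padic_ucont_ext gamma_nat_holder.
have Huc : padic_ucont (fun s => morita_gamma s * padic_ext (gamma_sum_nat z) s).
  by rewrite morita_gammaE; apply: padic_ucontM => //; exact: padic_ucont_ext.
suff : (fun s => morita_gamma (s + 1) * padic_ext (gamma_sum_nat z) (s + 1)) =
  (fun s => gamma_factor s * (morita_gamma s * padic_ext (gamma_sum_nat z) s) +
    padic_pow z s) by move=> /[swap] s /(congr1 (@^~ s)).
apply: eq_padic_ucont.
- apply: (padic_ucont_comp Huc); apply: padic_ucontD; first exact: padic_ucont_id.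
  exact: padic_ucont_cst.
- apply: padic_ucontD; last by rewrite padic_powE//; exact: padic_ucont_ext.
  by apply: padic_ucontM => //; exact: padic_ucont_gamma_factor.
move=> n _; rewrite natr1 !morita_gamma_nat padic_powE// !padic_ext_nat//.
(* The last summand, multiplied by [gamma_nat n.+1], leaves z^n; the others are covered by the
   recurrence of [gamma_nat]. *)
rewrite gamma_factor_nat mulrA -gamma_natS /gamma_sum_nat big_nat_recr//= mulrDr.
by congr (_ + _); rewrite mulrC divrK// gamma_nat_unit.
Qed.

End Gamma.

(** * The exponential on p Z_p *)

Section Exponential.
Variables (p : nat) (p_pr : prime p) (p_odd : odd p).
Local Notation Zp := (padicInt p_pr).
Local Notation Qp := (padic p_pr).

(** Legendre's formula bounds the valuation of n! by n/(p - 1), and p is at least 3. *)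
Lemma logn_fact_double_le n : ((logn p n`!).*2 <= n)%N.
Proof.
have p3 := odd_prime_gt2 p_odd p_pr.
(* Keeping the last quotient [n %/ p ^ m] on the left makes the induction work: the next quotient is
   at most a third of it. *)
have sumP m : ((\sum_(1 <= k < m.+1) n %/ p ^ k).*2 + n %/ p ^ m <= n)%N.
  elim: m => [|m IH]; first by rewrite big_geq// expn0 divn1.
  rewrite big_nat_recr//= expnSr divnMA.
  set a := (n %/ p ^ m)%N in IH *.
  have ab : (a %/ p * 3 <= a)%N.
    by apply: leq_trans (leq_divM a p); rewrite leq_mul2l p3 orbT.
  by lia.
by rewrite logn_fact//; exact: leq_trans (leq_addr _ _) (sumP n).
Qed.

Lemma padic_natr_neq0 n : (0 < n)%N -> n%:R != 0 :> Zp.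
Proof.
move=> n0; apply: contraTneq (ltn_expl n (prime_gt1 p_pr)) => n00.
have := congr1 (fun x : Zp => residue x n) n00; rewrite residue_nat residue0.
move=> /eqP; rewrite -/(dvdn _ _) => /(dvdn_leq n0); by rewrite -leqNgt.
Qed.

(** Here c is p^n/n!: the part of n! prime to p is inverted in Z_p, and its power of p is cancelled
    against p^n. *)
Lemma exp_coef_ex n : exists c : Zp,
  c * n`!%:R = p%:R ^+ n /\ residue c (n - logn p n`!) = 0%N.
Proof.
have [m cpm fE] := pfactor_coprime p_pr (fact_gt0 n); set v := logn p n`! in fE *.
have um : (m%:R : Zp) \is a GRing.unit.
  by rewrite padic_unitE residue_nat expn1 -/(dvdn _ _) -prime_coprime.
exists ((p ^ (n - v))%:R * m%:R^-1); split; last by rewrite residue_mull_eq0// residue_pX.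
have vn : (v <= n)%N by have := logn_fact_double_le n; rewrite -/v; lia.
by rewrite fE natrM mulrA divrK// -natrM -expnD subnK// natrX.
Qed.

(** By the valuation bound, the terms of index at least 2n vanish mod p^n. Hence exp_p(pz) mod p^n
    is a polynomial in z with coefficients in Z_p. *)
Lemma padic_exp_ex : exists E : Zp -> Zp,
  (forall z, padic_exp (p%:R * z%:Qp) = (E z)%:Qp) /\
  (forall n x y, residue x n = residue y n -> residue (E x) n = residue (E y) n).
Proof.
have [c cP] := choice exp_coef_ex.
have c0 n k : (n.*2 <= k)%N -> residue (c k) n = 0%N.
  move=> nk; have [_ ck] := cP k; rewrite -(residue0 p_pr n).
  apply: (@residue_congr_le _ _ n (k - logn p k`!)); last by rewrite ck residue0.
  by have := logn_fact_double_le k; lia.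
pose e z n := \sum_(0 <= k < n) c k * z ^+ k.
have eP z n m : (n.*2 <= m)%N -> residue (e z m) n = residue (e z n.*2) n.
  move=> nm; rewrite /e (big_cat_nat (n := n.*2) _ nm)//.
  rewrite -[RHS](congr1 (fun x : Zp => residue x n) (addr0 _)).
  apply: residue_congrD => //; rewrite big_nat.
  elim/big_rec: _ => // k x /andP[nk _] x0; rewrite -[in RHS](addr0 0).
  by apply: residue_congrD => //; rewrite residue_mull_eq0 ?residue0 ?c0.
have Eex z : exists x : Zp, forall n, residue x n = residue (e z n.*2) n.
  apply: (@padic_lim_ex _ p_pr (fun n => e z n.*2)) => n.
  by apply: eP; rewrite leq_double.
have [E EP] := choice Eex; exists E; split=> [z|n x y xy]; last first.
  rewrite !EP; apply: residue_congr_sum => k; apply: residue_congrM => //.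
  exact: residue_congrX.
rewrite /padic_exp; apply/cvg_lim; first exact: metric_hausdorff.
have -> : series (fun n => (p%:R * z%:Qp) ^+ n / n`!%:R : Qp) =
    @padic_inj p p_pr \o e z.
  apply/funext => n; rewrite /series /= /e rmorph_sum; apply: eq_bigr => k _.
  have f0 : k`!%:R != 0 :> Qp.
    by rewrite -(rmorph_nat (@padic_inj p p_pr)) tofrac_eq0 padic_natr_neq0// fact_gt0.
  apply: (mulIf f0); rewrite divfK// -(rmorph_nat (@padic_inj p p_pr) k`!) -rmorphM /=.
  by rewrite mulrAC (cP k).1 exprMn rmorphM !rmorphXn rmorph_nat.
apply: continuous_cvg; first exact: padic_inj_continuous.
move=> A /nbhs_padicP[n nA]; exists n.*2 => // m /= nm; apply: nA.
by rewrite eP// EP.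
Qed.

End Exponential.

(** * Joint continuity, functional equations and uniqueness *)

Theorem theorem2p7 (p : nat) (p_pr : prime p) (p_odd : odd p) :
  ({within gamma_domain p_pr,
      continuous (fun sz => incomplete_gamma sz.1 sz.2)} /\
   incomplete_gamma_eqs (incomplete_gamma (p_pr := p_pr))) /\
  (forall f : padicInt p_pr -> padicInt p_pr -> padic p_pr,
     {within gamma_domain p_pr, continuous (fun sz => f sz.1 sz.2)} ->
     incomplete_gamma_eqs f ->
     forall s z, one_units z -> f s z = incomplete_gamma s z).
Proof.
have [E [expE Ec]] := padic_exp_ex p_pr p_odd.
pose H z s := morita_gamma s * padic_ext (@gamma_sum_nat p p_pr z) s.
pose G s z := E z * H z s.
have GE s z : one_units z -> incomplete_gamma s z = (G s z)%:Qp.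
  by move=> z1; rewrite /incomplete_gamma expE gamma_sumE// -!rmorphM -mulrA.
(* Joint continuity as a congruence: mod p^n, [G] depends only on s mod p^(2n) and on z mod p^n. *)
have Gc n s t y z : one_units y -> one_units z ->
    residue s n.*2 = residue t n.*2 ->
    residue y n = residue z n -> residue (G s y) n = residue (G t z) n.
  move=> y1 z1 st yz; apply: residue_congrM; first exact: Ec.
  apply: residue_congrM.
    by rewrite morita_gammaE//; apply: residue_congr_ext => //; exact: gamma_nat_holder.
  rewrite !residue_ext ?st; try exact: gamma_sum_nat_holder.
  by apply: residue_congr_sum => k; apply: residue_congrM => //; exact: residue_congrX.
have eqs : incomplete_gamma_eqs (incomplete_gamma (p_pr := p_pr)).
  split=> [z z1|s z z1].
    (* The point 1 is read as a numeral, so that the values on natural numbers apply; the sum is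
       then 1/Gamma_p(1). *)
    rewrite GE// expE /G /H -[1](mulr1n 1) morita_gamma_nat//.
    rewrite padic_ext_nat; last first.
      exact: gamma_sum_nat_holder.
    by rewrite /gamma_sum_nat big_nat1 expr0 mul1r divrr ?mulr1// gamma_nat_unit.
  rewrite !GE// expE -!rmorphM -rmorphD /G /H morita_gamma_sumS//.
  by congr padic_inj; rewrite mulrDr mulrCA [E z * padic_pow _ _]mulrC.
split; first split=> //.
  apply/subspace_continuousP => -[s z] [_ /= z1] A nA.
  have {}nA : nbhs (G s z)%:Qp A by rewrite -GE.
  have := padic_inj_continuous nA => /nbhs_padicP[n nG].
  rewrite nbhs_simpl /within /=.
  exists ([set t | residue t n.*2 = residue s n.*2],
          [set y | residue y n = residue z n]) => /=.
    by split; apply/nbhs_padicP; [exists n.*2|exists n].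
  move=> [t y] /= [ts yz] [_ /= y1].
  have : A (G t y)%:Qp by apply: nG; exact: Gc.
  by rewrite -GE.
move=> f fc [f1 fS] s z z1; have [g1 gS] := eqs.
suff : f^~ z = incomplete_gamma^~ z by move/(congr1 (@^~ s)).
apply: eq_continuous_padic; first exact: metric_hausdorff.
- move=> t A nA.
  (* Joint continuity on the domain restricts to the slice at z, since z lies in each of its
     neighbourhoods. *)
  have /subspace_continuousP/(_ (t, z)) := fc.
  case/(_ _ _ nA); first by split.
  move=> [B C] /= [Bt Cz] BC.
  apply: filterS Bt => u Bu.
  by apply: (BC (u, z)); split => //=; exact: nbhs_singleton.
- rewrite (_ : incomplete_gamma^~ z = @padic_inj p p_pr \o (fun s => G s z)).
    move=> t; apply: continuous_comp; last exact: padic_inj_continuous.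
    by apply: padic_ucont_continuous => n; exists n.*2 => a b ab; exact: Gc.
  by apply/funext => t /=; rewrite GE.
(* Only positive integers are compared: the induction starts at s = 1, where condition (1)
   applies. *)
case=> // n _; elim: n => [|n IH]; first by rewrite f1// g1.
by rewrite -natr1 fS// gS// IH.
Qed.
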